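(* Let $\mathcal{M}$ be a standard finite von Neumann algebra on a Hilbert space $\mathcal{H}$, and let $\mathfrak{A}\subseteq\mathcal{B}(\mathcal{H})$ be a transitive algebra which contains $\mathcal{M}$. If $\mathfrak{A}$ is $2$-fold transitive, then $\mathfrak{A}$ is strongly dense in $\mathcal{B}(\mathcal{H})$.
   Context: $\mathcal{H}$ is a complex Hilbert space and $\mathcal{B}(\mathcal{H})$ the algebra of bounded operators on it. A von Neumann algebra $\mathcal{M}$ acting on $\mathcal{H}$ is standard if there exists a conjugate unitary operator $J:\mathcal{H}\to\mathcal{H}$ (a conjugate-linear surjective isometry) such that the mapping $X\mapsto JX^*J$ is a $*$-anti-isomorphism from $\mathcal{M}$ onto its commutant $\mathcal{M}'$. A subalgebra $\mathfrak{A}\subseteq\mathcal{B}(\mathcal{H})$ (not assumed self-adjoint or closed) is transitive if it contains the identity operator and has no invariant closed subspaces other than $\{0\}$ and $\mathcal{H}$. A transitive algebra $\mathfrak{A}$ is $2$-fold transitive if for any linearly independent vectors $\xi,\eta\in\mathcal{H}$ the norm closure of $\{(T\xi,T\eta): T\in\mathfrak{A}\}$ is $\mathcal{H}\oplus\mathcal{H}$. ''Strongly dense'' means dense in the strong operator topology. *)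

(* Defs.v *)
From HB Require Import structures.
From mathcomp Require Import all_boot all_order all_algebra.
From mathcomp Require Import sesquilinear complex.
From mathcomp Require Import boolp classical_sets functions reals topology.
From mathcomp Require Import normedtype.

Set Implicit Arguments.
Unset Strict Implicit.
Unset Printing Implicit Defensive.

Import Order.TTheory GRing.Theory Num.Theory.
Import numFieldNormedType.Exports.
Local Open Scope classical_set_scope.
Local Open Scope ring_scope.

(* Operators on H are plain functions H -> H, and B(H) is the set
   [bounded_op]. A Hilbert space is a complete normed module H over R[i] with a
   positive definite Hermitian form [dot], linear in its first variable, such
   that [is_hilbert dot]: the norm of H is the one induced by [dot]. *)
Section OperatorAlgebras.
Context {R : realType} {H : completeNormedModType R[i]}.
Variable dot : {dot H for Num.conj}.

Definition is_hilbert : Prop := forall x : H, `|x| ^+ 2 = dot x x.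

Definition bounded_op : set (H -> H) :=
  [set T | linear T /\ exists k : R[i], forall x, `|T x| <= k * `|x|].

Definition is_adjoint (T S : H -> H) : Prop :=
  bounded_op S /\ forall x y, dot (T x) y = dot x (S y).

(* The default value is irrelevant on bounded operators of a Hilbert space,
   which have exactly one adjoint by the Riesz representation theorem. *)
Definition adjoint (T : H -> H) : H -> H := xget T [set S | is_adjoint T S].

Record subalgebra (A : set (H -> H)) : Prop := {
  subalgebra_bounded : A `<=` bounded_op;
  subalgebra0 : A (fun=> 0);
  subalgebraD : forall S T, A S -> A T -> A (S \+ T);
  subalgebraZ : forall (c : R[i]) T, A T -> A (c \*: T);
  subalgebraM : forall S T, A S -> A T -> A (S \o T) }.

(* Pointwise convergence of operators is convergence of T xi for each xi. *)
Definition strong_op_topology : topologicalType := {ptws H -> H}.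

(* The coarsest topology making T |-> dot (T xi) eta continuous for all xi and
   eta. *)
Definition weak_op_topology : topologicalType :=
  @initial_topology (H -> H) {ptws H * H -> R[i]^o}
    (fun T p => dot (T p.1) p.2).

(* These topologies live on all functions H -> H; traces on B(H) give the
   operator topologies. *)
Definition strongly_dense (A : set (H -> H)) : Prop :=
  bounded_op `<=` closure (A : set strong_op_topology).

Definition weakly_closed (A : set (H -> H)) : Prop :=
  bounded_op `&` closure (A : set weak_op_topology) `<=` A.

Record von_neumann_algebra (M : set (H -> H)) : Prop := {
  vna_subalgebra : subalgebra M;
  vna_id : M idfun;
  vna_adjoint : forall T, M T -> M (adjoint T);
  vna_weakly_closed : weakly_closed M }.

Definition commutant (M : set (H -> H)) : set (H -> H) :=
  [set T | bounded_op T /\ forall S, M S -> T \o S = S \o T].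

Definition is_projection (E : H -> H) : Prop :=
  [/\ bounded_op E, E \o E = E & adjoint E = E].

Definition mvn_equivalent (M : set (H -> H)) (E F : H -> H) : Prop :=
  exists V, [/\ M V, adjoint V \o V = E & V \o adjoint V = F].

Definition finite_projection (M : set (H -> H)) (E : H -> H) : Prop :=
  forall F, M F -> is_projection F -> mvn_equivalent M E F ->
    range F `<=` range E -> F = E.

Definition finite_vna (M : set (H -> H)) : Prop :=
  von_neumann_algebra M /\ finite_projection M idfun.

Definition conjugate_unitary (J : H -> H) : Prop :=
  [/\ linear_for (Num.conj \; *:%R) J,
      forall x, `|J x| = `|x|
    & forall y, exists x, J x = y].

Record star_anti_isomorphism (M N : set (H -> H))
    (phi : (H -> H) -> (H -> H)) : Prop := {
  sai_bij : set_bij M N phi;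
  saiD : forall S T, M S -> M T -> phi (S \+ T) = phi S \+ phi T;
  saiZ : forall (c : R[i]) T, M T -> phi (c \*: T) = c \*: phi T;
  saiM : forall S T, M S -> M T -> phi (S \o T) = phi T \o phi S;
  sai_adjoint : forall T, M T -> phi (adjoint T) = adjoint (phi T) }.

Definition standard (M : set (H -> H)) : Prop :=
  exists2 J, conjugate_unitary J &
    star_anti_isomorphism M (commutant M) (fun X => J \o adjoint X \o J).

Record closed_subspace (K : set H) : Prop := {
  closed_subspace_closed : closed K;
  closed_subspace0 : K 0;
  closed_subspaceP : forall (c : R[i]) x y, K x -> K y -> K (c *: x + y) }.

Definition invariant (A : set (H -> H)) (K : set H) : Prop :=
  forall T x, A T -> K x -> K (T x).

Record transitive_algebra (A : set (H -> H)) : Prop := {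
  transitive_subalgebra : subalgebra A;
  transitive_id : A idfun;
  transitive_invariant : forall K, closed_subspace K -> invariant A K ->
    K = [set 0] \/ K = setT }.

Definition lin_indep2 (xi eta : H) : Prop :=
  forall a b : R[i], a *: xi + b *: eta = 0 -> a = 0 /\ b = 0.

(* The library's norm on H * H is the maximum of the two norms; it is
   equivalent to the Hilbert norm of the direct sum. *)
Definition two_fold_transitive (A : set (H -> H)) : Prop :=
  transitive_algebra A /\
  forall xi eta, lin_indep2 xi eta ->
    closure [set (T xi, T eta) | T in A] = [set: H * H].

End OperatorAlgebras.

(* Main.v *)
(* The operators on H that commute with M form an algebra in which, by
   standardness and finiteness, every isometry is surjective; hence H does not
   contain a copy of H + H as an M-module. It suffices to show, by induction on
   n, that a proper closed A-invariant subspace K of H^n satisfies a linear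
   relation with scalar coefficients. The vectors of K with first coordinate 0
   form such a subspace of H^(n-1). If it satisfies a relation given by g, the
   first coordinate k_0 determines g(k) for k in K. The pairs (k_0, g(k)) are
   not dense in H + H: if they were, both k |-> k_0 and k |-> (k_0, g(k)) would
   be injective with dense range on the orthogonal complement of their common
   kernel in K, and polar decomposition would identify H with H + H as
   M-modules. So, by 2-fold transitivity, k_0 and g(k) are proportional. *)

Require Import Defs.
From mathcomp Require Import all_boot all_order all_algebra.
From mathcomp Require Import sesquilinear complex.
From mathcomp Require Import boolp classical_sets functions reals topology.
From mathcomp Require Import normedtype.
From mathcomp Require Import ring lra.

Import Order.TTheory GRing.Theory Num.Theory.
Import numFieldNormedType.Exports.
Local Open Scope classical_set_scope.
Local Open Scope ring_scope.

Set Implicit Arguments.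
Unset Strict Implicit.
Unset Printing Implicit Defensive.

(** * Bounds of the form C / (k + 1) *)

Lemma eventually_small (R : realType) (C e : R) :
  0 < e -> exists k : nat, C / k.+1%:R < e.
Proof.
move=> e0; exists (Num.bound (C / e)).
rewrite ltr_pdivrMr ?ltr0Sn// mulrC -ltr_pdivrMr//.
apply: (le_lt_trans (ler_norm _)).
by rewrite (lt_trans (unstable.ltr_norm_bound _))// ltr_nat.
Qed.

Lemma small_le0 (R : realType) (C x : R) :
  (forall k : nat, x <= C / k.+1%:R) -> x <= 0.
Proof.
move=> h; rewrite leNgt; apply/negP => /(eventually_small C)[k].
by rewrite ltNge h.
Qed.

(** * The real inner product and norm *)

Section RealInnerProduct.
Context {R : realType} {H : completeNormedModType R[i]}.
Variable dot : {dot H for Num.conj}.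
Hypothesis hilb : is_hilbert dot.

(** The real part keeps all estimates in the ordered field [R]; by [dotE] it still determines
    [dot]. *)
Definition real_dot (x y : H) : R := complex.Re (dot x y).
Local Notation rdot := real_dot.
Definition rnorm (x : H) : R := complex.Re `|x|.

Lemma rnormE x : `|x| = (rnorm x)%:C%C.
Proof. by rewrite /rnorm RRe_real// ger0_real. Qed.

Lemma rnorm_ge0 x : 0 <= rnorm x.
Proof. by rewrite -ler0c -rnormE. Qed.

Lemma rnormD x y : rnorm (x + y) <= rnorm x + rnorm y.
Proof. by rewrite -lecR rmorphD /= -!rnormE ler_normD. Qed.

Lemma rnormN x : rnorm (- x) = rnorm x.
Proof. by rewrite /rnorm normrN. Qed.

Lemma rnormB x y : rnorm (x - y) <= rnorm x + rnorm y.
Proof. by rewrite -(rnormN y) rnormD. Qed.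

Lemma rnorm_distC x y : rnorm (x - y) = rnorm (y - x).
Proof. by rewrite -opprB rnormN. Qed.

Lemma rnorm0 : rnorm 0 = 0.
Proof. by rewrite /rnorm normr0. Qed.

Lemma rnorm_eq0 x : rnorm x <= 0 -> x = 0.
Proof.
move=> x0; apply/eqP; rewrite -normr_eq0 rnormE.
by rewrite (_ : rnorm x = 0)//; apply/eqP; rewrite eq_le x0 rnorm_ge0.
Qed.

Lemma rnormZ (c : R[i]) x : rnorm (c *: x) = complex.Re `|c| * rnorm x.
Proof. by rewrite /rnorm normrZ rnormE /= mulr0 subr0. Qed.

Lemma rnormZr (c : R) x : 0 <= c -> rnorm (c%:C%C *: x) = c * rnorm x.
Proof. by move=> c0; rewrite rnormZ ger0_norm// ler0c. Qed.

Lemma rnorm_sq x : rnorm x ^+ 2 = rdot x x.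
Proof. by rewrite /real_dot -hilb rnormE -rmorphXn. Qed.

Lemma rdotC x y : rdot x y = rdot y x.
Proof. by rewrite /real_dot hermC /= expr0 mul1r; case: (dot y x). Qed.

Lemma rdotDl x y z : rdot (x + y) z = rdot x z + rdot y z.
Proof. by rewrite /real_dot linearDl raddfD. Qed.

Lemma rdotDr x y z : rdot z (x + y) = rdot z x + rdot z y.
Proof. by rewrite !(rdotC z) rdotDl. Qed.

Lemma rdotZl (c : R) x y : rdot (c%:C%C *: x) y = c * rdot x y.
Proof.
by rewrite /real_dot linearZl_LR /=; case: (dot x y) => a b /=; rewrite mul0r subr0.
Qed.

Lemma rdotZr (c : R) x y : rdot x (c%:C%C *: y) = c * rdot x y.
Proof. by rewrite !(rdotC x) rdotZl. Qed.

Lemma rdotNl x y : rdot (- x) y = - rdot x y.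
Proof. by rewrite /real_dot linearNl raddfN. Qed.

Lemma rdotNr x y : rdot y (- x) = - rdot y x.
Proof. by rewrite !(rdotC y) rdotNl. Qed.

Lemma rdotBl x y z : rdot (x - y) z = rdot x z - rdot y z.
Proof. by rewrite rdotDl rdotNl. Qed.

Lemma rdotBr x y z : rdot z (x - y) = rdot z x - rdot z y.
Proof. by rewrite rdotDr rdotNr. Qed.

Lemma rdot0r x : rdot x 0 = 0.
Proof. by rewrite -(subrr x) rdotBr subrr. Qed.

Lemma rdotJ (c : R[i]) x y : rdot (c *: x) y = rdot x (c^* *: y).
Proof. by rewrite /real_dot linearZl_LR linearZr_LR /= conjCK. Qed.

Lemma rdotJr (c : R[i]) x y : rdot x (c *: y) = rdot (c^* *: x) y.
Proof. by rewrite rdotJ conjCK. Qed.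

Lemma dotE x y : dot x y = Complex (rdot x y) (rdot x ('i%C *: y)).
Proof.
by rewrite /real_dot linearZr_LR /=; case: (dot x y) => a b /=; congr Complex; lra.
Qed.

Lemma rdot_ge0 x : 0 <= rdot x x.
Proof. by rewrite -rnorm_sq sqr_ge0. Qed.

Lemma rnorm_le x y : rdot x x <= rdot y y -> rnorm x <= rnorm y.
Proof. by rewrite -!rnorm_sq ler_pXn2r ?nnegrE ?rnorm_ge0. Qed.

Lemma rdot_eq0 x : rdot x x <= 0 -> x = 0.
Proof.
move=> h; apply: rnorm_eq0; rewrite -rnorm0; apply: rnorm_le.
by rewrite rdot0r.
Qed.

(* The triangle inequality, squared. *)
Lemma rdot_le x y : rdot x y <= rnorm x * rnorm y.
Proof.
have := rnormD x y.
rewrite -(@ler_pXn2r _ 2%N)// ?nnegrE ?addr_ge0 ?rnorm_ge0//.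
rewrite sqrrD !rnorm_sq rdotDl !rdotDr (rdotC y x); lra.
Qed.

Lemma rdot_abs_le x y : `|rdot x y| <= rnorm x * rnorm y.
Proof.
rewrite ler_norml rdot_le andbT lerNl -rdotNl.
by rewrite (le_trans (rdot_le _ _))// rnormN.
Qed.

Lemma rdot_inj x y : (forall z, rdot z x = rdot z y) -> x = y.
Proof.
move=> h; apply/subr0_eq/rdot_eq0.
by rewrite rdotBr h subrr.
Qed.

(** Completeness with an explicit rate, which the limit inherits with the same constant; limits
    below are constructed in this form. *)
Lemma hilbert_complete (u : nat -> H) (C : R) :
    (forall k m, (k <= m)%N -> rnorm (u m - u k) <= C / k.+1%:R) ->
  exists v, forall k, rnorm (u k - v) <= C / k.+1%:R.
Proof.
move=> hu.
have : cvg (u @ \oo).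
  apply: cauchy_cvg; apply: cauchy_exP => e e0.
  have [er e0'] : e = (complex.Re e)%:C%C /\ 0 < complex.Re e.
    by move: e0; case: (e) => a b; rewrite ltcE /= => /andP[/eqP -> ->].
  have [k hk] := eventually_small C e0'.
  exists (u k); exists k => // m /= km.
  rewrite -ball_normE /= rnormE er ltcR (le_lt_trans _ hk)//.
  by rewrite rnorm_distC hu.
move=> /cvg_ex[v /cvgrPdist_lt uv]; exists v => k.
apply/ler_addgt0Pr => e e0.
have e0' : 0 < e%:C%C by rewrite ltcR.
have [m _ hm] := uv _ e0'.
have := hm (maxn m k) (leq_maxl _ _); rewrite rnormE ltcR => /ltW h1.
rewrite (_ : u k - v = (u k - u (maxn m k)) - (v - u (maxn m k))); last first.
  by rewrite opprB addrA subrK.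
by rewrite (le_trans (rnormB _ _))// lerD// rnorm_distC hu// leq_maxr.
Qed.

End RealInnerProduct.

(** * Closed invariant subspaces of H^I *)

Section Tuples.
Context {R : realType} {H : completeNormedModType R[i]}.
Variable dot : {dot H for Num.conj}.
Hypothesis hilb : is_hilbert dot.
Local Notation rdot := (real_dot dot).

Definition tuple_dot (I : finType) (x y : I -> H) : R := \sum_i rdot (x i) (y i).
Local Notation tdot := tuple_dot.

(** The norm closure in the product, with real radii. That [K] is closed is expressed below as the
    inclusion of [tclosure K] in [K]. *)
Definition tclosure (I : finType) (S : set (I -> H)) : set (I -> H) :=
  [set x | forall e : R, 0 < e ->
    exists2 k, S k & forall i, rnorm (x i - k i) <= e].

(** Enough structure for submodules to be complex subspaces and for their closures to be submodules.
    It covers [A], [M], the scalars alone and all bounded operators. *)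
Record operator_set (M : set (H -> H)) : Prop := {
  opset_linear : forall m, M m -> linear m;
  opset_bounded : forall m, M m ->
    exists2 C : R, 0 < C & forall x, rnorm (m x) <= C * rnorm x;
  opset_scale : forall c : R[i], M ( *:%R c) }.

Record submodule (M : set (H -> H)) (I : finType) (K : set (I -> H)) : Prop := {
  submod0 : K (fun=> 0);
  submodD : forall x y, K x -> K y -> K (fun i => x i + y i);
  submodM : forall m x, M m -> K x -> K (m \o x) }.

Lemma opsetD M m : operator_set M -> M m -> {morph m : x y / x + y}.
Proof.
by move=> oM Mm x y; have := opset_linear oM Mm 1 x y; rewrite !scale1r.
Qed.

Lemma opset0 M m : operator_set M -> M m -> m 0 = 0.
Proof.
move=> oM Mm; apply: (@addrI _ (m 0)).
by rewrite addr0 -(opsetD oM Mm) addr0.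
Qed.

Lemma opsetZ M m c x : operator_set M -> M m -> m (c *: x) = c *: m x.
Proof.
by move=> oM Mm; have := opset_linear oM Mm c x 0; rewrite (opset0 oM Mm) !addr0.
Qed.

Lemma opsetB M m x y : operator_set M -> M m -> m (x - y) = m x - m y.
Proof.
move=> oM Mm; apply: (@addIr _ (m y)).
by rewrite -(opsetD oM Mm) !subrK.
Qed.

Lemma submodZ M (I : finType) (K : set (I -> H)) c x :
  operator_set M -> submodule M K -> K x -> K (fun i => c *: x i).
Proof. by move=> oM sK Kx; apply: (submodM sK (opset_scale oM c)). Qed.

Lemma submodB M (I : finType) (K : set (I -> H)) x y :
  operator_set M -> submodule M K -> K x -> K y -> K (fun i => x i - y i).
Proof.
move=> oM sK Kx Ky; have := submodD sK Kx (submodZ (-1) oM sK Ky).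
by congr K; apply: funext => i; rewrite scaleN1r.
Qed.

Lemma tclosure_sub (I : finType) (S : set (I -> H)) : S `<=` tclosure S.
Proof.
move=> x Sx e e0; exists x => // i.
by rewrite subrr rnorm0 ltW.
Qed.

Lemma tclosureK (I : finType) (S : set (I -> H)) :
  tclosure (tclosure S) `<=` tclosure S.
Proof.
move=> x h e e0; have e2 : 0 < e / 2 by lra.
have [y Sy xy] := h _ e2; have [z Sz yz] := Sy _ e2.
exists z => // i; rewrite -(subrKA (y i)).
by rewrite (le_trans (rnormD _ _))// [leRHS]splitr lerD.
Qed.

Lemma tclosure_submodule M (I : finType) (S : set (I -> H)) :
  operator_set M -> submodule M S -> submodule M (tclosure S).
Proof.
move=> oM sS; split.
- exact/tclosure_sub/(submod0 sS).
- move=> x y Sx Sy e e0; have e2 : 0 < e / 2 by lra.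
  have [x' Sx' xx] := Sx _ e2; have [y' Sy' yy] := Sy _ e2.
  exists (fun i => x' i + y' i); first exact: (submodD sS).
  move=> i; rewrite opprD addrACA.
  by rewrite (le_trans (rnormD _ _))// [leRHS]splitr lerD.
- move=> m x Mm Sx e e0; have [C C0 mC] := opset_bounded oM Mm.
  have [y Sy xy] := Sx (e / C) (divr_gt0 e0 C0).
  exists (m \o y); first exact: (submodM sS).
  move=> i /=; rewrite -(opsetB _ _ oM Mm) (le_trans (mC _))//.
  by rewrite mulrC -ler_pdivlMr.
Qed.

Section Tdot.
Variable I : finType.
Implicit Types x y z : I -> H.

Lemma tdotC x y : tdot x y = tdot y x.
Proof. by apply: eq_bigr => i _; rewrite rdotC. Qed.

Lemma tdotDl x y z : tdot (fun i => x i + y i) z = tdot x z + tdot y z.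
Proof. by rewrite -big_split; apply: eq_bigr => i _; rewrite rdotDl. Qed.

Lemma tdotZl (c : R) x z : tdot (fun i => c%:C%C *: x i) z = c * tdot x z.
Proof. by rewrite /tuple_dot mulr_sumr; apply: eq_bigr => i _; rewrite rdotZl. Qed.

Lemma tdotBl x y z : tdot (fun i => x i - y i) z = tdot x z - tdot y z.
Proof. by rewrite -sumrB; apply: eq_bigr => i _; rewrite rdotBl. Qed.

Lemma tdotBr x y z : tdot z (fun i => x i - y i) = tdot z x - tdot z y.
Proof. by rewrite !(tdotC z) tdotBl. Qed.

Lemma tdot_ge0 x : 0 <= tdot x x.
Proof. by apply: sumr_ge0 => i _; exact: rdot_ge0. Qed.

Lemma rdot_le_tdot x i : rdot (x i) (x i) <= tdot x x.
Proof.
rewrite /tuple_dot (bigD1 i)//= lerDl.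
by apply: sumr_ge0 => j _; exact: rdot_ge0.
Qed.

Lemma tdot_eq0 x : tdot x x <= 0 -> forall i, x i = 0.
Proof.
by move=> h i; apply: (rdot_eq0 hilb); exact: le_trans (rdot_le_tdot x i) h.
Qed.

Lemma tdot_inj M (K : set (I -> H)) x y :
    operator_set M -> submodule M K -> K x -> K y ->
  (forall k, K k -> tdot k x = tdot k y) -> x = y.
Proof.
move=> oM sK Kx Ky h; apply: funext => i; apply/subr0_eq.
pose d i := x i - y i; have Kd : K d by exact: submodB sK Kx Ky.
by rewrite -/(d i) tdot_eq0// tdotBr h// subrr.
Qed.

Lemma rdot_le_half (x y : H) : 2 * rdot x y <= rdot x x + rdot y y.
Proof.
have := rdot_ge0 hilb (x - y).
rewrite rdotBl !rdotBr (rdotC _ y x); lra.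
Qed.

Lemma two_tdot_le x y : 2 * tdot x y <= tdot x x + tdot y y.
Proof.
rewrite mulr_sumr -big_split ler_sum// => i _; exact: rdot_le_half.
Qed.

(* The representative is the limit of a minimizing sequence of the functional
   [k |-> tdot k k - 2 * l k]. *)
Lemma riesz M (K : set (I -> H)) (l : (I -> H) -> R) (C : R) :
    operator_set M -> submodule M K -> tclosure K `<=` K ->
    (forall (c : R) x y, K x -> K y ->
      l (fun i => c%:C%C *: x i + y i) = c * l x + l y) ->
    (forall x, K x -> 2 * l x <= tdot x x + C) ->
  exists2 p, K p & forall k, K k -> tdot k p = l k.
Proof.
move=> oM sK cK lin bnd.
pose J x := tdot x x - 2 * l x.
have infJ : has_inf [set J x | x in K].
  split; first by exists (J (fun=> 0)); exists (fun=> 0) => //; exact: submod0 sK.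
  exists (- C) => _ [x Kx <-]; rewrite /J; have := bnd _ Kx; lra.
(* The tolerance is a square so that [b2] yields the rate 1 / (n + 1) in [nb]. *)
have [d d0 dE] : exists2 d : nat -> R,
    forall n, 0 < d n & forall n, d n = n.+1%:R^-1 ^+ 2.
  by exists (fun n => n.+1%:R^-1 ^+ 2) => // n; rewrite exprn_gt0// invr_gt0 ltr0Sn.
have /choice [u hu] : forall n, exists x, K x /\ J x < inf [set J x | x in K] + d n.
  by move=> n; have [_ [x Kx <-] h] := inf_adherent (d0 n) infJ; exists x.
have Ku n : K (u n) by case: (hu n).
(* Moving [u n] by c times [k] changes [J] by this quadratic polynomial in c, and cannot lower it by
   more than [d n]. *)
have var n k (c : R) : K k ->
    - d n <= c ^+ 2 * tdot k k + 2 * c * (tdot k (u n) - l k).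
  move=> Kk; pose y i := c%:C%C *: k i + u n i.
  have Ky : K y by apply: (submodD sK) => //; exact: submodZ oM sK Kk.
  have : inf [set J x | x in K] <= J y by apply: ge_inf; [case: infJ|exists y].
  have [_] := hu n; rewrite /J lin//.
  have -> : tdot y y = c ^+ 2 * tdot k k + 2 * c * tdot k (u n) + tdot (u n) (u n).
    rewrite {1}/y tdotDl tdotZl !(tdotC _ y) /y !tdotDl !tdotZl (tdotC (u n) k).
    by ring.
  lra.
have b2 n k : K k -> (tdot k (u n) - l k) ^+ 2 <= tdot k k * d n.
  move=> Kk; apply/ler_addgt0Pr => e e0.
  set b := _ - _; set q := tdot k k; have q0 : 0 <= q by exact: tdot_ge0.
  have w0 : 0 < q + e / d n by rewrite ltr_wpDl// divr_gt0.
  (* This c nearly minimizes the quadratic; the summand [e / d n] keeps the denominator positive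
     when [q] is 0. *)
  have := var n k (- b / (q + e / d n)) Kk; rewrite -/b -/q => h.
  have : b ^+ 2 / (q + e / d n) <= d n.
    rewrite -lerN2 (le_trans h)//.
    rewrite -subr_ge0 [X in 0 <= X](_ : _ = (b / (q + e / d n)) ^+ 2 * (e / d n)).
      by apply: mulr_ge0; [exact: sqr_ge0|apply: divr_ge0; exact: ltW].
    by field; rewrite !gt_eqF// ltr_wpDl// mulr_ge0// ltW.
  rewrite ler_pdivrMr// => /le_trans; apply.
  rewrite le_eqVlt; apply/orP; left; apply/eqP; field.
  by rewrite gt_eqF.
have nb n k : K k -> `|tdot k (u n) - l k| <= Num.sqrt (tdot k k) / n.+1%:R.
  move=> Kk; rewrite -(@ler_pXn2r _ 2)// ?nnegrE ?divr_ge0 ?sqrtr_ge0//.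
  by rewrite real_normK ?num_real// exprMn sqr_sqrtr ?tdot_ge0// -dE b2.
have cau n m : (n <= m)%N ->
    Num.sqrt (tdot (fun i => u m i - u n i) (fun i => u m i - u n i)) <= 2 / n.+1%:R.
  (* [nb] is tested on the difference [k] itself: [s ^+ 2] is the difference of two numbers within s
     / (m + 1) and s / (n + 1) of [l k], and one factor [s] cancels. *)
  move=> nm; set k := fun i => _; have Kk : K k by exact: submodB oM sK _ _.
  set s := Num.sqrt _; have := nb n k Kk; have := nb m k Kk; rewrite -/s.
  have s0 : 0 <= s by exact: sqrtr_ge0.
  have : s ^+ 2 = tdot k (u m) - tdot k (u n).
    by rewrite sqr_sqrtr ?tdot_ge0// -tdotBr.
  have : s / m.+1%:R <= s / n.+1%:R.
    by rewrite ler_wpM2l// lef_pV2 ?posrE ?ltr0Sn// ler_nat.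
  rewrite !ler_norml => h1 h2 /andP[h3 h4] /andP[h5 h6].
  have [->|sN0] := eqVneq s 0; first by rewrite divr_ge0.
  have sp : 0 < s by rewrite lt_def sN0.
  rewrite -(ler_pM2l sp) -expr2 h2 mulrCA mulr_natl mulr2n.
  rewrite -(subrKA (l k)) lerD ?(le_trans h4)// -opprB lerNl //.
have /choice [p hp] : forall i, exists v, forall n, rnorm (u n i - v) <= 2 / n.+1%:R.
  move=> i; apply: hilbert_complete => n m nm.
  apply: le_trans (cau _ _ nm).
  rewrite -(@ler_pXn2r _ 2)// ?nnegrE ?rnorm_ge0 ?sqrtr_ge0//.
  by rewrite sqr_sqrtr ?tdot_ge0// (rnorm_sq hilb) (rdot_le_tdot _ i).
have Kp : K p.
  apply: cK => e e0; have [n hn] := eventually_small 2 e0.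
  by exists (u n) => // i; rewrite rnorm_distC (le_trans (hp _ _))// ltW.
exists p => // k Kk; apply/subr0_eq/eqP; rewrite -normr_le0.
apply: (@small_le0 _ (\sum_i rnorm (k i) * 2 + Num.sqrt (tdot k k))) => n.
rewrite -(subrKA (tdot k (u n))) (le_trans (ler_normD _ _))// mulrDl lerD ?nb//.
rewrite -tdotBr mulr_suml (le_trans (ler_norm_sum _ _ _))// ler_sum// => i _.
rewrite (le_trans (rdot_abs_le hilb _ _))// -mulrA ler_wpM2l ?rnorm_ge0//.
by rewrite rnorm_distC hp.
Qed.

End Tdot.

(** The projection of [z] represents on [K] the functional k |-> tdot k z, which [two_tdot_le]
    bounds as [riesz] requires. *)
Lemma orthogonal_projection M (I : finType) (K : set (I -> H)) (z : I -> H) :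
    operator_set M -> submodule M K -> tclosure K `<=` K ->
  exists2 w, K w & forall k, K k -> tdot k w = tdot k z.
Proof.
move=> oM sK cK.
apply: (@riesz _ _ _ (fun k => tdot k z) (tdot z z) oM sK cK).
  by move=> c x y _ _; rewrite tdotDl tdotZl.
by move=> x _; exact: two_tdot_le.
Qed.

Lemma riesz_full (l : H -> R) (C : R) :
    (forall (c : R) x y, l (c%:C%C *: x + y) = c * l x + l y) ->
    (forall x, 2 * l x <= rdot x x + C) ->
  exists p, forall k, rdot k p = l k.
Proof.
move=> lin bnd.
have td (x y : unit -> H) : tdot x y = rdot (x tt) (y tt).
  by rewrite /tuple_dot (bigD1 tt)//= big1 ?addr0// => -[].
pose M : set (H -> H) := [set m | exists c : R[i], m = *:%R c].
have oM : operator_set M.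
  split; last by move=> c; exists c.
  - by move=> _ [c ->] a x y; rewrite scalerDr !scalerA mulrC.
  - move=> _ [c ->]; exists (complex.Re `|c| + 1).
      by rewrite ltr_wpDl// -ler0c RRe_real// ger0_real.
    by move=> x; rewrite rnormZ ler_wpM2r ?rnorm_ge0// lerDl.
have bnd' (x : unit -> H) : [set: unit -> H] x -> 2 * l (x tt) <= tdot x x + C.
  by rewrite td.
have [|//||p _ hp] := riesz oM _ _ _ bnd' => //.
by exists (p tt) => k; rewrite -(hp (fun=> k))// td.
Qed.

End Tuples.

(** * Polar decomposition *)

Section Polar.
Context {R : realType} {H : completeNormedModType R[i]}.
Variable dot : {dot H for Num.conj}.
Hypothesis hilb : is_hilbert dot.
Local Notation rdot := (real_dot dot).

Lemma rlim_unique (u : nat -> H) (a b : H) (C D : R) :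
    (forall k, rnorm (u k - a) <= C / k.+1%:R) ->
    (forall k, rnorm (u k - b) <= D / k.+1%:R) -> a = b.
Proof.
move=> ua ub; apply/subr0_eq/rnorm_eq0/(@small_le0 _ (C + D)) => k.
rewrite -(subrKA (u k)) mulrDl (le_trans (rnormD _ _))// lerD ?ub//.
by rewrite rnorm_distC ua.
Qed.

Lemma half_double (x : H) : (2^-1)%:C%C *: x + (2^-1)%:C%C *: x = x.
Proof.
by rewrite -scalerDl -rmorphD /= (_ : 2^-1 + 2^-1 = 1) ?scale1r//; field.
Qed.

Lemma additive_half (f : H -> H) x :
  {morph f : x y / x + y} -> f ((2^-1)%:C%C *: x) = (2^-1)%:C%C *: f x.
Proof.
by move=> fD; rewrite -{2}(half_double x) fD scalerDr half_double.
Qed.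

(* For a self-adjoint contraction [A], this iteration for [Y = (A + Y ^+ 2) / 2]
   converges strongly, and then [1 - Y] is a square root of [1 - A]. *)
Fixpoint half_iter (A : H -> H) (k : nat) : H -> H :=
  if k is k'.+1 then fun x =>
    (2^-1)%:C%C *: (A x + half_iter A k' (half_iter A k' x))
  else fun=> 0.

(* The iteration with [A] replaced by the scalar 1: its increments bound those
   of [half_iter]. *)
Fixpoint half_scalar (k : nat) : R :=
  if k is k'.+1 then (1 + half_scalar k' ^+ 2) / 2 else 0.

Lemma half_scalar_ge0 k : 0 <= half_scalar k.
Proof. by case: k => //= k; have := sqr_ge0 (half_scalar k); lra. Qed.

Lemma half_scalar_le1 k : half_scalar k <= 1.
Proof. elim: k => //= k IH; have := half_scalar_ge0 k; nra. Qed.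

Lemma half_scalar_homo : {homo half_scalar : k n / (k <= n)%N >-> k <= n}.
Proof.
apply: homo_leq => [//|? ? ?|k /=]; first exact: le_trans.
have := sqr_ge0 (1 - half_scalar k); nra.
Qed.

Lemma half_scalar_gap k : 1 - half_scalar k <= 2 / k.+1%:R.
Proof.
(* The gap g evolves by g |-> g - g^2 / 2, and the bound 2 / (k + 2) is preserved because (k + 1)(k
   + 3) <= (k + 2)^2. *)
suff h : 1 - half_scalar k <= 2 / k.+2%:R.
  by apply: (le_trans h); rewrite ler_wpM2l// lef_pV2 ?posrE ?ltr0Sn// ler_nat.
elim: k => [|k IH]; first by rewrite /= subr0 ler_pdivlMr ?mul1r.
set s := half_scalar k in IH *; rewrite /= -/s.
have s0 : 0 <= s by exact: half_scalar_ge0.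
have s1 : s <= 1 by exact: half_scalar_le1.
set t : R := k%:R; have t0 : 0 <= t by exact: ler0n.
have e2 : k.+2%:R = t + 2 :> R by rewrite -natrD addn2.
have e3 : k.+3%:R = t + 3 :> R by rewrite -natrD addn3.
move: IH; rewrite e2 e3 !ler_pdivlMr; try lra.
by move=> IH; nra.
Qed.

Section Iteration.
Variables (M : set (H -> H)) (A : H -> H).
Hypothesis oM : operator_set M.
Hypothesis AD : {morph A : x y / x + y}.
Hypothesis A1 : forall x, rnorm (A x) <= rnorm x.
Hypothesis Asym : forall x y, rdot (A x) y = rdot x (A y).
Hypothesis AM : forall m x, M m -> A (m x) = m (A x).
Local Notation y := (half_iter A).
Local Notation s := half_scalar.

Lemma half_iterD k : {morph y k : x z / x + z}.
Proof.
elim: k => [|k IH] x z /=; first by rewrite addr0.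
by rewrite AD !IH -scalerDr addrACA.
Qed.

Lemma half_iterB k x z : y k (x - z) = y k x - y k z.
Proof. by apply: (@addIr _ (y k z)); rewrite -half_iterD !subrK. Qed.

Lemma half_iterM k m x : M m -> y k (m x) = m (y k x).
Proof.
move=> Mm; elim: k x => [|k IH] x /=; first by rewrite (opset0 oM).
rewrite AM// !IH -(opsetD oM Mm) -additive_half//.
exact: opsetD oM Mm.
Qed.

Lemma half_iter_sym k x z : rdot (y k x) z = rdot x (y k z).
Proof.
elim: k x z => [|k IH] x z /=; first by rewrite (rdotC _ 0) !rdot0r.
by rewrite rdotZl rdotZr rdotDl rdotDr Asym !IH.
Qed.

Lemma half_iter_le k x : rnorm (y k x) <= s k * rnorm x.
Proof.
elim: k x => [|k IH] x /=; first by rewrite rnorm0 mul0r.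
rewrite rnormZr; last by rewrite invr_ge0.
rewrite mulrC mulrAC ler_wpM2r ?invr_ge0// (le_trans (rnormD _ _))//.
rewrite mulrDl mul1r lerD// (le_trans (IH _))// expr2 -mulrA.
by rewrite ler_wpM2l// half_scalar_ge0.
Qed.

Lemma half_iter_dist k n x : (k <= n)%N ->
  rnorm (y n x - y k x) <= (s n - s k) * rnorm x.
Proof.
elim: k n x => [|k IH] n x; first by rewrite !subr0 half_iter_le.
case: n => // n kn.
(* The difference of squares is split as (Y_n - Y_k) Y_n + Y_k (Y_n - Y_k), which needs no
   commutation; the scalar iteration satisfies the same identity. *)
have -> : y n.+1 x - y k.+1 x =
    (2^-1)%:C%C *: (y n (y n x) - y k (y n x) + y k (y n x - y k x)).
  by rewrite /= -scalerBr half_iterB subrKA opprD addrACA subrr add0r.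
rewrite rnormZr ?invr_ge0//=.
rewrite [leRHS](_ : _ = 2^-1 *
  ((s n - s k) * (s n * rnorm x) + s k * ((s n - s k) * rnorm x))); last first.
  by field.
rewrite ler_wpM2l ?invr_ge0// (le_trans (rnormD _ _))//.
rewrite lerD ?(le_trans (IH _ _ kn)) ?(le_trans (half_iter_le _ _))//.
  by rewrite ler_wpM2l ?half_iter_le// subr_ge0 half_scalar_homo.
by rewrite ler_wpM2l ?half_scalar_ge0 ?IH.
Qed.

(** The last equation says that (1 - Y)^2 = 1 - A. Only additivity is tracked, since complex
    linearity is part of commuting with [M], which contains the scalars. *)
Lemma half_fixpoint : exists Y : H -> H, [/\ {morph Y : x z / x + z},
  forall m x, M m -> Y (m x) = m (Y x),
  forall x z, rdot (Y x) z = rdot x (Y z) &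
  forall x, Y x + Y x = A x + Y (Y x)].
Proof.
have /choice [Y hY] : forall x, exists v,
    forall k, rnorm (y k x - v) <= 2 * rnorm x / k.+1%:R.
  move=> x; apply: hilbert_complete => k n kn.
  rewrite (le_trans (half_iter_dist _ kn))// mulrAC ler_wpM2r ?rnorm_ge0//.
  by rewrite (le_trans _ (half_scalar_gap k))// lerB// half_scalar_le1.
exists Y; split.
- move=> x z; apply: rlim_unique (hY (x + z)) _ => k.
  rewrite half_iterD opprD addrACA (le_trans (rnormD _ _))//.
  by rewrite (le_trans (lerD (hY _ _) (hY _ _)))// -mulrDl.
- move=> m x Mm; have [C C0 mC] := opset_bounded oM Mm.
  apply: rlim_unique (hY (m x)) _ => k.
  rewrite half_iterM// -(opsetB _ _ oM Mm) (le_trans (mC _))//.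
  by rewrite (le_trans (ler_wpM2l (ltW C0) (hY _ _)))// mulrA.
- move=> x z; apply/subr0_eq/eqP; rewrite -normr_le0.
  apply: (@small_le0 _ (2 * rnorm x * rnorm z + rnorm x * (2 * rnorm z))) => k.
  rewrite -(subrKA (rdot (y k x) z)) (le_trans (ler_normD _ _))// mulrDl lerD//.
    rewrite -rdotBl (le_trans (rdot_abs_le hilb _ _))// mulrAC ler_wpM2r ?rnorm_ge0//.
    by rewrite rnorm_distC hY.
  rewrite half_iter_sym -rdotBr (le_trans (rdot_abs_le hilb _ _))// -mulrA.
  by rewrite ler_wpM2l ?rnorm_ge0 ?hY.
(* [u k] is twice the next iterate, so it tends to [Y x + Y x]; it also tends to [A x + Y (Y x)], as
   each iterate is a contraction. *)
- move=> x; pose u k := A x + y k (y k x).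
  apply: (@rlim_unique u _ _ (4 * rnorm x) (2 * rnorm x + 2 * rnorm (Y x))) => k.
    have -> : u k = y k.+1 x + y k.+1 x.
      by rewrite /= half_double.
    rewrite opprD addrACA (le_trans (rnormD _ _))//.
    rewrite (le_trans (lerD (hY _ _) (hY _ _)))// -mulrDl -mulrDl -natrD.
    rewrite ler_wpM2l ?mulr_ge0 ?rnorm_ge0// lef_pV2 ?posrE ?ltr0Sn// ler_nat//.
  rewrite /u opprD addrACA subrr add0r -(subrKA (y k (Y x))) -half_iterB mulrDl.
  rewrite (le_trans (rnormD _ _))// lerD// (le_trans (half_iter_le _ _))//.
  apply: le_trans (hY x k); rewrite ler_piMl ?rnorm_ge0//.
  exact: half_scalar_le1.
Qed.

End Iteration.
End Polar.

(** * The isometry of a polar decomposition *)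

Section PolarDecomposition.
Context {R : realType} {H : completeNormedModType R[i]}.
Variable dot : {dot H for Num.conj}.
Hypothesis hilb : is_hilbert dot.
Local Notation rdot := (real_dot dot).
Local Notation tdot := (tuple_dot dot).

Definition star_closed (M : set (H -> H)) : Prop := forall m, M m ->
  exists2 n, M n & forall x y, rdot (m x) y = rdot x (n y).

Section Isometry.
Variables (M : set (H -> H)) (I : finType) (e : I -> H -> H).
Hypothesis oM : operator_set M.
Hypothesis sM : star_closed M.
Hypothesis eD : forall i, {morph e i : x y / x + y}.
Hypothesis eM : forall i m x, M m -> e i (m x) = m (e i x).
Hypothesis e1 : forall x, tdot (e^~ x) (e^~ x) <= rdot x x.

(** Let e : H -> H^I have the components [e i]. Riesz representation gives Q, the product of the
    adjoint of e with e; it commutes with [M] because [M] is closed under adjoints. Then 1 - Q is a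
    contraction, and [half_fixpoint] provides the square root B of Q. *)
Lemma polar_modulus : exists B : H -> H, [/\ {morph B : x y / x + y},
  forall m x, M m -> B (m x) = m (B x) &
  forall x y, rdot (B x) (B y) = tdot (e^~ x) (e^~ y)].
Proof.
have /choice [Q hQ] : forall x, exists q,
    forall k, rdot k q = tdot (e^~ k) (e^~ x).
  move=> x.
  apply: (@riesz_full _ _ _ hilb (fun k => tdot (e^~ k) (e^~ x))
    (tdot (e^~ x) (e^~ x))).
    move=> c k k'; rewrite -(tdotZl dot) -(tdotDl dot); congr tdot.
    by apply: funext => i; rewrite eD eM//; exact: opset_scale.
  by move=> k; rewrite (le_trans (two_tdot_le hilb _ _))// lerD2r.
have QD : {morph Q : x y / x + y}.
  move=> x y; apply: (rdot_inj hilb) => z; rewrite rdotDr !hQ !(tdotC _ (e^~ z)).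
  by rewrite -(tdotDl dot); congr tdot; apply: funext => i; rewrite eD.
have QN x : Q (- x) = - Q x.
  by apply/eqP; rewrite -addr_eq0 -QD addNr; apply/eqP/(@addIr _ (Q 0));
    rewrite -QD !add0r.
have Qsym x y : rdot (Q x) y = rdot x (Q y) by rewrite rdotC !hQ tdotC.
have QM m x : M m -> Q (m x) = m (Q x).
  move=> Mm; have [n Mn mn] := sM Mm; apply: (rdot_inj hilb) => z.
  rewrite (rdotC _ z (m _)) mn (rdotC _ (Q x)) !hQ.
  apply: eq_bigr => i _ /=; rewrite (eM _ _ Mm) (eM _ _ Mn).
  by rewrite (rdotC _ _ (m _)) mn; exact: rdotC.
pose A x := x - Q x.
have [||||Y [YD YM Ysym YE]] := @half_fixpoint _ _ _ hilb M A oM.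
- by move=> x y; rewrite /A QD opprD addrACA.
(* Contractivity of e and [two_tdot_le] give <Qx, Qx> <= <x, Qx>, hence |x - Qx|^2 <= |x|^2. *)
- move=> x; apply: (rnorm_le hilb); rewrite /A rdotBl !rdotBr !(rdotC _ (Q x)).
  have := two_tdot_le hilb (e^~ (Q x)) (e^~ x); have := e1 (Q x).
  rewrite -(hQ x (Q x)) -(hQ x x).
  have := rdot_ge0 hilb (Q x); lra.
- by move=> x y; rewrite /A rdotBl rdotBr Qsym.
- by move=> m x Mm; rewrite /A QM// -(opsetB _ _ oM Mm).
exists (fun x => x - Y x); split.
- by move=> x y; rewrite YD opprD addrACA.
- by move=> m x Mm; rewrite YM// -(opsetB _ _ oM Mm).
move=> x y; rewrite -hQ rdotBl Ysym -rdotBr; congr rdot.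
have YB : Y (y - Y y) = Y y - Y (Y y).
  by apply: (@addIr _ (Y (Y y))); rewrite -YD !subrK.
rewrite YB opprB addrC addrA addrAC -(addrA (Y (Y y))) -opprD YE opprD addrCA.
by rewrite subrr addr0 /A opprB subrK.
Qed.

Hypothesis edense : forall (z : I -> H) (d : R), 0 < d ->
  exists u, forall i, rnorm (z i - e i u) <= d.

Lemma rdot_approx (a b a' b' : H) (d : R) : d <= 1 ->
    rnorm (a - a') <= d -> rnorm (b - b') <= d ->
  `|rdot a b - rdot a' b'| <= (rnorm a + rnorm b + 1) * d.
Proof.
move=> d1 ha hb; have hb' : rnorm b' <= rnorm b + 1.
  rewrite -[b'](subKr b) (le_trans (rnormB _ _))// lerD2l.
  exact: le_trans hb d1.
rewrite -(subrKA (rdot a b')) -rdotBr -rdotBl (le_trans (ler_normD _ _))//.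
rewrite -addrA mulrDl lerD// (le_trans (rdot_abs_le hilb _ _))//.
  by rewrite ler_wpM2l ?rnorm_ge0.
by rewrite mulrC ler_pM ?rnorm_ge0.
Qed.

(* [V] is defined by its graph, the closure of the pairs [(e^~ u, B u)]. *)
Lemma polar_isometry : exists V : (I -> H) -> H, [/\
  forall x y, V (fun i => x i + y i) = V x + V y,
  forall m x, M m -> V (m \o x) = m (V x) &
  forall x y, rdot (V x) (V y) = tdot x y].
Proof.
have [B [BD BM BE]] := polar_modulus.
have e0 i : e i 0 = 0 by apply: (@addrI _ (e i 0)); rewrite -eD !addr0.
have B0 : B 0 = 0 by apply: (@addrI _ (B 0)); rewrite -BD !addr0.
have eB i x y : e i (x - y) = e i x - e i y.
  by apply: (@addIr _ (e i y)); rewrite -eD !subrK.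
have BB x y : B (x - y) = B x - B y.
  by apply: (@addIr _ (B y)); rewrite -BD !subrK.
pose gr (x : I -> H) (v : H) : option I -> H := oapp x v.
pose S : set (option I -> H) := [set gr (e^~ u) (B u) | u in setT].
have oS : submodule M S.
  split.
  - by exists 0 => //; apply: funext => -[i|] /=.
  - move=> _ _ [u _ <-] [v _ <-]; exists (u + v) => //.
    by apply: funext => -[i|] /=; rewrite ?eD ?BD.
  - move=> m _ Mm [u _ <-]; exists (m u) => //.
    by apply: funext => -[i|] /=; rewrite ?(eM _ _ Mm) ?(BM _ _ Mm).
have oG := tclosure_submodule oM oS.
(* The relation between [B] and [e] extends to the closed graph by continuity; at the zero tuple it
   makes the graph single-valued. *)
have GE x v x' v' : tclosure S (gr x v) -> tclosure S (gr x' v') ->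
    rdot v v' = tdot x x'.
  move=> G G'; apply/subr0_eq/eqP; rewrite -normr_le0.
  pose c (a b : H) := rnorm a + rnorm b + 1.
  apply: (@small_le0 _ (c v v' + \sum_i c (x i) (x' i))) => n.
  have n0 : 0 < n.+1%:R^-1 :> R by rewrite invr_gt0.
  have n1 : n.+1%:R^-1 <= 1 :> R by rewrite invf_le1// ler1n.
  have [_ [u _ <-] hu] := G _ n0; have [_ [u' _ <-] hu'] := G' _ n0.
  have -> : rdot v v' - tdot x x' = rdot v v' - rdot (B u) (B u') +
      \sum_i (rdot (e i u) (e i u') - rdot (x i) (x' i)).
    by rewrite BE sumrB addrA subrK.
  rewrite (le_trans (ler_normD _ _))// mulrDl lerD//.
    by rewrite rdot_approx// ?(hu None) ?(hu' None).
  rewrite mulr_suml (le_trans (ler_norm_sum _ _ _))// ler_sum// => i _.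
  by rewrite distrC rdot_approx// ?(hu (Some i)) ?(hu' (Some i)).
have Guniq x v v' : tclosure S (gr x v) -> tclosure S (gr x v') -> v = v'.
  move=> G G'; have := submodB oM oG G G'.
  have -> : (fun o => gr x v o - gr x v' o) = gr (fun=> 0) (v - v').
    by apply: funext => -[i|] //=; rewrite subrr.
  move=> G0; apply/subr0_eq/(rdot_eq0 hilb); rewrite (GE _ _ _ _ G0 G0).
  by rewrite /tuple_dot big1// => i _; rewrite rdot0r.
(* Every tuple is a limit of values [e^~ (u n)], and [B (u n)] is then Cauchy because [B] reproduces
   the distances of these values. *)
have /choice [V hV] : forall x, exists v, tclosure S (gr x v).
  move=> x; have /choice [u hu] : forall n : nat,
      exists u, forall i, rnorm (x i - e i u) <= n.+1%:R^-1.
    by move=> n; apply: edense; rewrite invr_gt0.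
  (* Summing #|I| squared coordinate bounds needs only #|I| <= c^2; the successor makes c >= 1, so
     that the same n serves the coordinates in [I]. *)
  pose c : R := #|I|.+1%:R.
  have [n m nm|v hv] := @hilbert_complete _ _ (B \o u) (c * 2).
    rewrite -(@ler_pXn2r _ 2)// ?nnegrE ?rnorm_ge0 ?divr_ge0 ?mulr_ge0//.
    rewrite (rnorm_sq hilb) /= -BB BE.
    have h i : rdot (e i (u m - u n)) (e i (u m - u n)) <= (2 / n.+1%:R) ^+ 2.
      rewrite -(rnorm_sq hilb) ler_pXn2r ?nnegrE ?rnorm_ge0 ?divr_ge0//.
      rewrite eB -(subrKA (x i)) (le_trans (rnormD _ _))//.
      rewrite mulr_natl mulr2n lerD ?hu// rnorm_distC (le_trans (hu _ _))//.
      by rewrite lef_pV2 ?posrE// ler_nat.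
    rewrite (le_trans (ler_sum _ (fun i _ => h i)))// sumr_const -[leLHS]mulr_natl.
    rewrite -mulrA [leRHS]exprMn ler_wpM2r ?sqr_ge0// /c -natrX ler_nat.
    by rewrite (leq_trans (leqnSn _))// leq_pmulr.
  exists v => d d0; have [n hn] := eventually_small (c * 2) d0.
  exists (gr (e^~ (u n)) (B (u n))); first by exists (u n).
  have c1 : 1 <= c * 2 by rewrite -natrM ler1n.
  case=> [i|] /=; last by rewrite rnorm_distC (le_trans (hv n))// ltW.
  rewrite (le_trans (hu n i))// (le_trans _ (ltW hn))//.
  by rewrite ler_peMl// invr_ge0.
exists V; split.
- move=> x y; apply: Guniq (hV _) _; have := submodD oG (hV x) (hV y).
  by congr (tclosure S _); apply: funext => -[i|].
- move=> m x Mm; apply: Guniq (hV _) _; have := submodM oG Mm (hV x).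
  by congr (tclosure S _); apply: funext => -[i|].
- by move=> x y; exact: GE (hV x) (hV y).
Qed.

End Isometry.
End PolarDecomposition.

(** * A non-surjective isometry commuting with [M] *)

Section NonSurjective.
Context {R : realType} {H : completeNormedModType R[i]}.
Variable dot : {dot H for Num.conj}.
Hypothesis hilb : is_hilbert dot.
Local Notation rdot := (real_dot dot).
Local Notation tdot := (tuple_dot dot).
Variables (M : set (H -> H)) (I : finType) (i0 : I) (c : I -> R[i]).
Hypothesis oM : operator_set M.
Hypothesis sM : star_closed dot M.

Definition combination (k : I -> H) : H := \sum_i c i *: k i.
Local Notation g := combination.

Let a (x : H) (i : I) : H := if i == i0 then x else 0.

Lemma combinationD k k' : g (fun i => k i + k' i) = g k + g k'.
Proof. by rewrite /g -big_split; apply: eq_bigr => i _; rewrite scalerDr. Qed.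

Lemma combination0 : g (fun=> 0) = 0.
Proof. by rewrite /g big1// => i _; rewrite scaler0. Qed.

Lemma combinationM m k : M m -> g (m \o k) = m (g k).
Proof.
move=> Mm; rewrite /g (big_morph _ (opsetD oM Mm) (opset0 oM Mm)).
by apply: eq_bigr => i _; rewrite (opsetZ _ _ oM Mm).
Qed.

(** This and [tdot_g] give the adjoints of the maps sending k to [k i0] and to [g k]. *)
Let tdot_a k x : tdot k (a x) = rdot (k i0) x.
Proof.
rewrite /tuple_dot (bigD1 i0)//= /a eqxx big1 ?addr0// => i /negPf ->.
by rewrite rdot0r.
Qed.

Let tdot_g k x : tdot k (fun i => (c i)^* *: x) = rdot (g k) x.
Proof.
have rdot_suml : {morph rdot^~ x : y z / y + z} by move=> y z; exact: rdotDl.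
rewrite /g (big_morph _ rdot_suml (rdotC dot 0 x)) ?rdot0r.
  by apply: eq_bigr => i _; rewrite rdotJ.
Qed.

Variable K : set (I -> H).
Hypothesis sK : submodule M K.
Hypothesis cK : tclosure K `<=` K.
Hypothesis gK : forall k, K k -> k i0 = 0 -> g k = 0.
Hypothesis dK : forall (x y : H) (d : R), 0 < d ->
  exists2 k, K k & rnorm (x - k i0) <= d /\ rnorm (y - g k) <= d.

(** On [K], [p] is a multiple of the adjoint of k |-> k i0, and [e] is [p] followed by k |-> (k i0,
    g k). Its range is dense: the pairs are dense by [dK], and an element of [K] orthogonal to the
    range of [p] has [k i0 = 0], hence by [gK] gives the pair (0, 0). *)
Lemma dense_pair_contraction : exists e : bool -> H -> H, [/\
  forall b, {morph e b : x y / x + y},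
  forall b m x, M m -> e b (m x) = m (e b x),
  forall x, tdot (e^~ x) (e^~ x) <= rdot x x &
  forall (z : bool -> H) (d : R), 0 < d ->
    exists u, forall b, rnorm (z b - e b u) <= d].
Proof.
pose G : R := \sum_i complex.Re `|c i|.
have c0 i : 0 <= complex.Re `|c i| by rewrite -ler0c RRe_real// ger0_real.
have G0 : 0 <= G by exact: sumr_ge0.
(* With this factor every coordinate of [p x] has norm at most t |x|, and [g (p x)] at most G t |x|;
   the squares t^2 and (G t)^2 add up to at most 1. *)
pose t : R := (1 + G)^-1.
have t0 : 0 < t by rewrite invr_gt0; lra.
have tG : t * (1 + G) = 1 by rewrite mulVf// gt_eqF//; lra.
have /choice [p hp] : forall x, exists w, K w /\
    forall k, K k -> tdot k w = t * rdot (k i0) x.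
  move=> x; have [w Kw hw] := orthogonal_projection hilb (a (t%:C%C *: x)) oM sK cK.
  by exists w; split=> // k Kk; rewrite hw// tdot_a rdotZr.
have Kp x : K (p x) by case: (hp x).
have pE x k : K k -> tdot k (p x) = t * rdot (k i0) x by case: (hp x) => _; apply.
have pD x y : p (x + y) = fun i => p x i + p y i.
  apply: (tdot_inj hilb oM sK (Kp _) (submodD sK (Kp x) (Kp y))).
  by move=> k Kk; rewrite [RHS]tdotC tdotDl !(tdotC _ _ k) !pE// rdotDr mulrDr.
have pM m x : M m -> p (m x) = m \o p x.
  move=> Mm; have [n Mn mn] := sM Mm.
  apply: (tdot_inj hilb oM sK (Kp _) (submodM sK Mm (Kp x))).
  move=> k Kk; rewrite pE// rdotC mn rdotC.
  have := pE x (n \o k) (submodM sK Mn Kk); rewrite /= => <-.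
  by apply: eq_bigr => i _ /=; rewrite rdotC -mn rdotC.
pose e b x := if b then p x i0 else g (p x).
have eD b : {morph e b : x y / x + y}.
  by case: b => x y; rewrite /e pD// combinationD.
have eM b m x : M m -> e b (m x) = m (e b x).
  by case: b => Mm; rewrite /e (pM _ _ Mm)// combinationM.
exists e; split=> //.
- move=> x; have r0 := rnorm_ge0 x.
  have q1 : tdot (p x) (p x) = t * rdot (p x i0) x by rewrite pE.
  have b0 : rnorm (p x i0) <= t * rnorm x.
    have h1 := rdot_le_tdot hilb (p x) i0; have h2 := rdot_le hilb (p x i0) x.
    move: h1; rewrite q1 -(rnorm_sq hilb) => h1.
    have : rnorm (p x i0) * rnorm (p x i0) <= rnorm (p x i0) * (t * rnorm x).
      by rewrite -expr2 (le_trans h1)// mulrCA ler_wpM2l// ltW.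
    have [->|] := eqVneq (rnorm (p x i0)) 0; first by rewrite mulr_ge0// ltW.
    by move=> N0; rewrite ler_pM2l// lt_def N0 rnorm_ge0.
  have b1 i : rnorm (p x i) <= t * rnorm x.
    rewrite -(@ler_pXn2r _ 2)// ?nnegrE ?rnorm_ge0 ?mulr_ge0 ?(ltW t0)//.
    rewrite (rnorm_sq hilb) (le_trans (rdot_le_tdot hilb (p x) i))// q1.
    rewrite expr2 mulrAC -mulrA ler_wpM2l ?(ltW t0)//.
    by rewrite (le_trans (rdot_le hilb _ _))// ler_wpM2r.
  have b2 : rnorm (g (p x)) <= G * (t * rnorm x).
    rewrite /g /G mulr_suml.
    elim/big_ind2: _ => [|u u' v v' h h'|i _].
    - by rewrite rnorm0.
    - by rewrite (le_trans (rnormD _ _))// lerD.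
    - by rewrite rnormZ ler_wpM2l.
  rewrite /tuple_dot big_bool /= -!(rnorm_sq hilb).
  have := rnorm_ge0 (p x i0); have := rnorm_ge0 (g (p x)).
  move: (rnorm (g (p x))) (rnorm (p x i0)) (rnorm x) b0 b2 r0 => v u r.
  have rE : r = (1 + G) * (t * r) by rewrite mulrA (mulrC _ t) tG mul1r.
  rewrite [X in _ -> _ <= X ^+ 2]rE.
  move: (t * r) => s us vs _ v0 u0; have s0 : 0 <= s by exact: le_trans us.
  rewrite (le_trans (lerD (_ : _ <= s ^+ 2) (_ : _ <= (G * s) ^+ 2)))//.
  - by rewrite ler_pXn2r ?nnegrE.
  - by rewrite ler_pXn2r ?nnegrE ?mulr_ge0.
  by rewrite mulrDl mul1r sqrrD lerD2r lerDl mulrn_wge0// mulr_ge0// mulr_ge0.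
- move=> z d d0.
  pose S : set (bool -> H) := [set e^~ u | u in setT].
  have e0 b : e b 0 = 0.
    by apply: (@addrI _ (e b 0)); rewrite -eD !addr0.
  have oS : submodule M S.
    split; first by exists 0 => //; apply: funext => b.
      move=> _ _ [u _ <-] [v _ <-]; exists (u + v) => //.
      by apply: funext => b; rewrite eD.
    move=> m _ Mm [u _ <-]; exists (m u) => //.
    by apply: funext => b /=; rewrite (eM _ _ _ Mm).
  suff : tclosure S z by move=> /(_ _ d0) [_ [u _ <-] hu]; exists u.
  have [w Sw hw] := orthogonal_projection hilb z oM (tclosure_submodule oM oS)
    (@tclosureK _ _ _ S).
  (* [h] is the part of [z] orthogonal to the closed range of [e], to be shown zero. *)
  pose h b := z b - w b.
  have hE k : tclosure S k -> tdot k h = 0 by move=> Sk; rewrite tdotBr hw// subrr.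
  (* [q] is the adjoint of k |-> (k i0, g k) applied to [h]. It is orthogonal to the range of [p],
     so [q i0] and [g q] vanish, and then so does [q]. *)
  have [q Kq hq] := orthogonal_projection hilb
    (fun i => a (h true) i + (c i)^* *: h false) oM sK cK.
  have qE k : K k -> tdot k q = rdot (k i0) (h true) + rdot (g k) (h false).
    move=> Kk; rewrite hq// tdotC tdotDl !(tdotC _ _ k) tdot_a.
    by rewrite tdot_g.
  have q0 : q i0 = 0.
    apply: (rdot_eq0 hilb); rewrite -(ler_pM2l t0) mulr0 -pE// tdotC qE//.
    have : tclosure S (e^~ (q i0)) by apply: tclosure_sub; exists (q i0).
    by move=> /hE; rewrite /tuple_dot big_bool => ->.
  have q00 : q = fun=> 0.
    apply: funext; apply: (tdot_eq0 hilb).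
    by rewrite qE// q0 gK// !(rdotC _ 0) !rdot0r addr0.
  have h0 : tdot h h <= 0.
    pose C := rnorm (h true) + rnorm (h false).
    apply: (@small_le0 _ C) => n; have n0 : 0 < n.+1%:R^-1 :> R by rewrite invr_gt0.
    have [k Kk [k1 k2]] := dK (h true) (h false) n0.
    have := qE k Kk; rewrite q00 /tuple_dot big1; last by move=> i _; rewrite rdot0r.
    move=> E; rewrite big_bool /= -[leLHS]subr0 E opprD addrACA -!rdotBl.
    rewrite mulrDl lerD// (le_trans (rdot_le hilb _ _))//.
      by rewrite mulrC ler_wpM2l ?rnorm_ge0.
    by rewrite mulrC ler_wpM2l ?rnorm_ge0.
  have -> : z = w by apply: funext => b; apply/subr0_eq; exact: (tdot_eq0 hilb h0).
  by [].
Qed.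

Lemma nonsurjective_isometry (z : H) : z <> 0 -> exists V : H -> H, [/\
  {morph V : x y / x + y},
  forall m x, M m -> V (m x) = m (V x),
  forall x y, rdot (V x) (V y) = rdot x y &
  exists2 v, v <> 0 & forall x, rdot (V x) v = 0].
Proof.
move=> z0; have [e [eD eM e1 ed]] := dense_pair_contraction.
have [V [VD VM VE]] := polar_isometry hilb oM sM eD eM e1 ed.
(* The isometry from H + H to H is restricted to the first summand; the image of the second summand
   is orthogonal to its range. *)
pose l (x : H) (b : bool) := if b then x else 0.
exists (fun x => V (l x)); split.
- by move=> x y; rewrite -VD; congr V; apply: funext => -[] //=; rewrite addr0.
- move=> m x Mm; rewrite -(VM _ _ Mm); congr V; apply: funext => -[] //=.
  by rewrite (opset0 oM).
- by move=> x y; rewrite VE /tuple_dot big_bool /= rdot0r addr0.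
exists (V (fun b => if b then 0 else z)).
  move=> V0; apply: z0; apply: (rdot_eq0 hilb).
  have := VE (fun b => if b then 0 else z) (fun b => if b then 0 else z).
  by rewrite V0 /tuple_dot big_bool /= !rdot0r add0r => <-.
by move=> x; rewrite VE /tuple_dot big_bool /= rdot0r rdotC rdot0r addr0.
Qed.

End NonSurjective.

(** * Adjoints and finiteness *)

Section Adjoints.
Context {R : realType} {H : completeNormedModType R[i]}.
Variable dot : {dot H for Num.conj}.
Hypothesis hilb : is_hilbert dot.
Local Notation rdot := (real_dot dot).
Implicit Types S T : H -> H.

Lemma bounded_op_rnorm T : bounded_op T ->
  exists2 C : R, 0 < C & forall x, rnorm (T x) <= C * rnorm x.
Proof.
move=> [_ [k kT]]; exists (`|complex.Re k| + 1); first by rewrite ltr_wpDl.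
move=> x; have := kT x; rewrite !rnormE lecE => /andP[_] /=.
case: k kT => kr ki kT /=; rewrite mulr0 subr0 => h.
rewrite (le_trans h)// ler_wpM2r ?rnorm_ge0//.
by rewrite (le_trans (ler_norm _))// lerDl.
Qed.

Lemma bounded_opI T (C : R) :
  linear T -> (forall x, rnorm (T x) <= C * rnorm x) -> bounded_op T.
Proof.
move=> lT bT; split=> //; exists C%:C%C => x.
by rewrite !rnormE -rmorphM /= lecR.
Qed.

Lemma bounded_operator_set : operator_set (@bounded_op R H).
Proof.
split; [by move=> m []|exact: bounded_op_rnorm|move=> c].
apply: (@bounded_opI _ (complex.Re `|c|)); last by move=> x; rewrite rnormZ.
by move=> a x y; rewrite scalerDr !scalerA mulrC.
Qed.

Lemma subalgebra_operator_set (M : set (H -> H)) :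
  subalgebra M -> M idfun -> operator_set M.
Proof.
move=> aM M1; split.
- by move=> m /(subalgebra_bounded aM)[].
- by move=> m /(subalgebra_bounded aM); exact: bounded_op_rnorm.
- by move=> c; exact: (subalgebraZ aM c M1).
Qed.

Lemma rdot_adjoint T S : is_adjoint dot T S ->
  forall x y, rdot (T x) y = rdot x (S y).
Proof. by move=> [_ h] x y; rewrite /real_dot h. Qed.

Lemma is_adjoint_unique T S S' :
  is_adjoint dot T S -> is_adjoint dot T S' -> S = S'.
Proof.
move=> /rdot_adjoint h /rdot_adjoint h'; apply: funext => y.
by apply: (rdot_inj hilb) => z; rewrite -h h'.
Qed.

Lemma is_adjoint_sym T S :
  bounded_op T -> is_adjoint dot T S -> is_adjoint dot S T.
Proof.
move=> bT [bS h]; split=> // x y.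
by rewrite [LHS]hermC [RHS]hermC /= h.
Qed.

Lemma is_adjoint_exists T : bounded_op T -> exists S, is_adjoint dot T S.
Proof.
move=> bT; have [C C0 bC] := bounded_op_rnorm bT; have [lT _] := bT.
have TZ c x : T (c *: x) = c *: T x by exact: opsetZ bounded_operator_set bT.
have /choice [S hS] : forall y, exists s, forall x, rdot x s = rdot (T x) y.
  move=> y; apply: (@riesz_full _ _ _ hilb (fun x => rdot (T x) y)
    (C ^+ 2 * rnorm y ^+ 2)).
    by move=> c x z; rewrite lT rdotDl rdotZl.
  move=> x; rewrite -(rnorm_sq hilb).
  have h1 := rdot_le hilb (T x) y.
  have h2 : rnorm (T x) * rnorm y <= C * rnorm x * rnorm y.
    by rewrite ler_wpM2r ?rnorm_ge0.
  (* This gives 2 C |x| |y| <= |x|^2 + C^2 |y|^2, whence the constant passed to [riesz_full]. *)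
  have := sqr_ge0 (rnorm x - C * rnorm y); nra.
have Slin : linear S.
  move=> c x y; apply: (rdot_inj hilb) => z.
  rewrite !rdotDr !hS rdotDr.
  by congr (_ + _); rewrite !rdotJr hS TZ.
exists S; split.
  apply: (@bounded_opI _ C) => // y.
  have [->|N0] := eqVneq (rnorm (S y)) 0; first by rewrite mulr_ge0 ?rnorm_ge0 ?ltW.
  have sp : 0 < rnorm (S y) by rewrite lt_def N0 rnorm_ge0.
  rewrite -(ler_pM2l sp) -expr2 (rnorm_sq hilb) hS.
  rewrite (le_trans (rdot_le hilb _ _))// mulrCA mulrA ler_wpM2r ?rnorm_ge0//.
by move=> x y; rewrite !dotE hS; congr Complex; rewrite [RHS]rdotJr hS TZ -rdotJr.
Qed.

Lemma adjointP T : bounded_op T -> is_adjoint dot T (adjoint dot T).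
Proof. by move=> bT; apply: xgetPex; exact: is_adjoint_exists. Qed.

Lemma adjointE T S : is_adjoint dot T S -> adjoint dot T = S.
Proof.
move=> h; apply: (@is_adjoint_unique T _ _ _ h).
by apply: (@xgetPex _ T [set S | is_adjoint dot T S]); exists S.
Qed.

Lemma adjointK T : bounded_op T -> adjoint dot (adjoint dot T) = T.
Proof.
by move=> bT; exact: adjointE (is_adjoint_sym bT (adjointP bT)).
Qed.

Lemma vna_star_closed M : von_neumann_algebra dot M -> star_closed dot M.
Proof.
move=> vM m Mm; exists (adjoint dot m); first exact: vna_adjoint.
by apply/rdot_adjoint/adjointP/(subalgebra_bounded (vna_subalgebra vM)).
Qed.

(** Write V as the image of X in [M]. The anti-isomorphism reverses products, so V being an isometry
    makes X a co-isometry; finiteness makes X unitary, and mapping back makes V unitary. *)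
Lemma commutant_isometry_surjective M V :
    finite_vna dot M -> standard dot M -> commutant M V ->
    (forall x y, rdot (V x) (V y) = rdot x y) ->
  V \o adjoint dot V = idfun.
Proof.
move=> [vM fM] [J _ sJ] cV isoV.
have aM := vna_subalgebra vM; have bM := subalgebra_bounded aM.
have M1 := vna_id vM.
set phi := fun X => J \o adjoint dot X \o J in sJ.
have [_ phi_inj phi_surj] := sai_bij sJ.
(* The identity has a preimage W, and W = W \o idfun is sent to [phi idfun \o phi W]. *)
have phi1 : phi idfun = idfun.
  have c1 : commutant M idfun by split=> //; exact: bM.
  have [W MW W1] := phi_surj _ c1.
  have h : phi W = phi idfun \o phi W := saiM sJ MW M1.
  by rewrite W1 in h; exact: esym h.
have [X MX XV] := phi_surj V cV.
have MX' : M (adjoint dot X) by exact: vna_adjoint vM _ MX.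
have XX' : X \o adjoint dot X = idfun.
  apply: phi_inj; rewrite ?inE//; first exact: (subalgebraM aM).
  rewrite phi1 [LHS](saiM sJ MX MX') [phi X]XV (sai_adjoint sJ MX) [phi X]XV.
  apply: funext => y; apply: (rdot_inj hilb) => x /=.
  by rewrite -(rdot_adjoint (adjointP (cV.1))) isoV.
have aX := adjointP (bM _ MX); have aX' := is_adjoint_sym (bM _ MX) aX.
have MF : M (adjoint dot X \o X) by exact: (subalgebraM aM).
have F1 : adjoint dot X \o X = idfun.
  apply: fM => //.
  - split; first exact: bM.
    + by rewrite -compA (compA X) XX'.
    + apply: adjointE; split; first exact: bM.
      by move=> x y /=; rewrite aX'.2 aX.2.
  (* The adjoint of X realizes the equivalence of 1 with the projection [adjoint dot X \o X], by
     [XX']. *)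
  - exists (adjoint dot X); split=> //; rewrite (adjointK (bM _ MX))//.
rewrite -[in LHS]XV -(sai_adjoint sJ MX).
by rewrite -[LHS](saiM sJ MX' MX) F1.
Qed.
End Adjoints.

(** * Density *)

Section Dichotomies.
Context {R : realType} {H : completeNormedModType R[i]}.
Variable dot : {dot H for Num.conj}.
Hypothesis hilb : is_hilbert dot.
Variables (M A : set (H -> H)).
Hypothesis finM : finite_vna dot M.
Hypothesis stM : standard dot M.
Hypothesis trA : transitive_algebra A.
Hypothesis MA : M `<=` A.

Let oA : operator_set A.
Proof.
have [aA A1 _] := trA; exact: subalgebra_operator_set.
Qed.

Let vM : von_neumann_algebra dot M := finM.1.

Let oM : operator_set M.
Proof. exact: subalgebra_operator_set (vna_subalgebra vM) (vna_id vM). Qed.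

(** [V] commutes with the scalars in [M], so it is linear and lies in the commutant. Being
    surjective, it has [v] in its range, and [v] is orthogonal to itself. *)
Lemma commutant_isometry_range V v :
    {morph V : x y / x + y} -> (forall m x, M m -> V (m x) = m (V x)) ->
    (forall x y, real_dot dot (V x) (V y) = real_dot dot x y) ->
    (forall x, real_dot dot (V x) v = 0) -> v = 0.
Proof.
move=> VD VM isoV Vv.
have cV : commutant M V.
  split; last by move=> m Mm; apply: funext => x /=; exact: VM.
  apply: (@bounded_opI _ _ _ 1).
    by move=> c x y; rewrite VD (VM ( *:%R c))//; exact: opset_scale oM c.
  move=> x; rewrite mul1r; apply: (rnorm_le hilb).
  by rewrite isoV.
have VV := commutant_isometry_surjective hilb finM stM cV isoV.
apply: (rdot_eq0 hilb); have /= := Vv (adjoint dot V v).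
by have /= -> := congr1 (fun f => f v) VV => ->.
Qed.

(* Modulo [k i0 = 0], [K] would map injectively and densely both to [H] and to
   [H * H], giving an isometric copy of [H * H] in [H]. *)
Lemma no_dense_pair (I : finType) (i0 : I) (c : I -> R[i]) (K : set (I -> H)) :
    submodule A K -> tclosure K `<=` K ->
    (forall k, K k -> k i0 = 0 -> combination c k = 0) ->
    (forall (x y : H) (d : R), 0 < d -> exists2 k, K k &
      rnorm (x - k i0) <= d /\ rnorm (y - combination c k) <= d) ->
  forall z : H, z = 0.
Proof.
move=> sK cK gK dK z; apply: contrapT => z0.
have sKM : submodule M K.
  split; [exact: submod0 sK|exact: submodD sK|].
  by move=> m x Mm; exact: (submodM sK (MA Mm)).
have [V [VD VM isoV [v v0 Vv]]] :=
  nonsurjective_isometry hilb oM (vna_star_closed hilb vM) sKM cK gK dK z0.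
exact/v0/(commutant_isometry_range VD VM isoV Vv).
Qed.

Lemma transitive_dichotomy (K : set H) :
    K 0 -> (forall x y, K x -> K y -> K (x + y)) -> Defs.invariant A K ->
    (forall x, (forall d : R, 0 < d -> exists2 k, K k & rnorm (x - k) <= d) ->
      K x) ->
  (forall x, K x -> x = 0) \/ (forall x, K x).
Proof.
move=> K0 KD KA Kc.
have KZ (c : R[i]) x : K x -> K (c *: x).
  by move=> Kx; exact: (KA ( *:%R c) x (opset_scale oA c) Kx).
have [||->|->] := transitive_invariant trA (K := K).
- split=> //; last by move=> c x y Kx Ky; apply: KD => //; exact: KZ.
  move=> x cx; apply: Kc => d d0.
  have d0' : 0 < d%:C%C by rewrite ltcR.
  have [k [Kk]] := cx _ (nbhsx_ballx x _ d0').
  rewrite -ball_normE /= rnormE ltcR => /ltW; by exists k.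
- by [].
- by left.
- by right.
Qed.

Hypothesis tfA : two_fold_transitive A.

Lemma two_fold_dense (xi eta x y : H) (d : R) : lin_indep2 xi eta -> 0 < d ->
  exists2 T, A T & rnorm (x - T xi) <= d /\ rnorm (y - T eta) <= d.
Proof.
move=> li d0; have d0' : 0 < d%:C%C by rewrite ltcR.
have : closure [set (T xi, T eta) | T in A] (x, y) by rewrite (tfA.2 _ _ li).
move=> /(_ _ (nbhsx_ballx (x, y) _ d0')) [_ [[T AT <-]]] [/=].
rewrite -!ball_normE /= !rnormE !ltcR => h1 h2; exists T => //.
by split; exact: ltW.
Qed.

(** One independent pair in [L] is moved by [A] to a dense set of pairs. Otherwise [k false] is
    always a multiple of [k true], and comparing k, a fixed k0 and k0 + k shows that one factor
    serves all of [L]. *)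
Lemma pair_dichotomy (L : set (bool -> H)) : submodule A L ->
    (forall k, L k -> k true = 0 -> k false = 0) ->
  (forall (x y : H) (d : R), 0 < d -> exists2 k, L k &
      rnorm (x - k true) <= d /\ rnorm (y - k false) <= d) \/
  exists a b : R[i], (a != 0 \/ b != 0) /\
    forall k, L k -> a *: k true + b *: k false = 0.
Proof.
move=> sL L0.
have [[k Lk li]|nli] := pselect (exists2 k, L k & lin_indep2 (k true) (k false)).
  left=> x y d d0; have [T AT h] := two_fold_dense x y li d0.
  by exists (T \o k) => //; exact: (submodM sL).
right.
have eig k : L k -> exists l, k false = l *: k true.
  move=> Lk; have [l1|nl] := pselect (exists l, k false = l *: k true) => //.
  case: nli; exists k => // a b ab.
  have b0 : b = 0.
    apply: contrapT => /eqP b0; apply: nl; exists (- (b^-1 * a)).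
    apply: (scalerI b0); rewrite scalerA mulrN mulVKf// scaleNr.
    by apply/eqP; rewrite -addr_eq0 addrC ab.
  split=> //; apply: contrapT => /eqP a0; apply: nl; exists 0.
  rewrite scale0r L0//; apply: (scalerI a0); rewrite scaler0.
  by rewrite -ab b0 scale0r addr0.
have [[k0 Lk0 /eqP x0]|all0] := pselect (exists2 k, L k & k true <> 0); last first.
  exists 1, 0; split; first by left; exact: oner_neq0.
  move=> k Lk; rewrite scale1r scale0r addr0.
  by apply: contrapT => k1; apply: all0; exists k.
have [l hl] := eig _ Lk0.
exists l, (-1); split; first by right; rewrite oppr_eq0 oner_neq0.
move=> k Lk; rewrite scaleN1r; apply/eqP; rewrite subr_eq0 eq_sym; apply/eqP.
have [mu hmu] := eig _ Lk; have [nu] := eig _ (submodD sL Lk0 Lk).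
rewrite hl hmu scalerDr => /eqP.
rewrite -subr_eq0 opprD addrACA -!scalerBl addr_eq0 -scaleNr opprB => /eqP E.
have [nm|nm] := eqVneq nu mu.
  move: E; rewrite nm subrr scale0r => /eqP.
  by rewrite scaler_eq0 (negPf x0) orbF subr_eq0 => /eqP ->.
have nm0 : nu - mu != 0 by rewrite subr_eq0.
(* Here [k true] is r times [k0 true], so [k] minus r times [k0] has first entry 0, and [L0]
   compares the second entries. *)
pose r := (nu - mu)^-1 * (l - nu).
have xr : k true = r *: k0 true by rewrite -scalerA E scalerA mulVf// scale1r.
have Ld := submodB oA sL Lk (submodZ r oA sL Lk0).
have /= := L0 _ Ld; rewrite xr subrr => /(_ erefl)/subr0_eq.
by rewrite hmu hl xr => ->; rewrite !scalerA mulrC.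
Qed.

Definition cons_tuple n (x : H) (y : 'I_n -> H) (i : 'I_n.+1) : H :=
  oapp y x (unlift ord0 i).

Lemma cons_tuple0 n x (y : 'I_n -> H) : cons_tuple x y ord0 = x.
Proof. by rewrite /cons_tuple unlift_none. Qed.

Lemma cons_tupleS n x (y : 'I_n -> H) i : cons_tuple x y (lift ord0 i) = y i.
Proof. by rewrite /cons_tuple liftK. Qed.

Lemma cons_tuple_ext n x (y : 'I_n -> H) z :
  z ord0 = x -> (forall i, z (lift ord0 i) = y i) -> z = cons_tuple x y.
Proof.
move=> z0 zS; apply: funext => i.
by case: (unliftP ord0 i) => [j|] ->; rewrite ?cons_tuple0 ?cons_tupleS.
Qed.

Lemma submodule_dichotomy n (K : set ('I_n -> H)) :
    submodule A K -> tclosure K `<=` K ->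
  (forall x, K x) \/ exists2 c : 'I_n -> R[i], (exists i, c i != 0) &
    forall k, K k -> combination c k = 0.
Proof.
elim: n K => [|n IH] K sK cK.
  left=> x; have -> : x = fun=> 0 by apply: funext => -[].
  exact: submod0 sK.
pose K1 : set ('I_n -> H) := [set y | K (cons_tuple 0 y)].
have sK1 : submodule A K1.
  split; rewrite /K1 /=.
  - by rewrite -(cons_tuple_ext (z := fun=> 0))//; exact: submod0 sK.
  - move=> x y Kx Ky; have := submodD sK Kx Ky.
    congr K; apply: cons_tuple_ext; first by rewrite !cons_tuple0 addr0.
    by move=> i; rewrite !cons_tupleS.
  - move=> m x Am Kx; have := submodM sK Am Kx.
    congr K; apply: cons_tuple_ext => /=; first by rewrite cons_tuple0 (opset0 oA).
    by move=> i /=; rewrite cons_tupleS.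
have cK1 : tclosure K1 `<=` K1.
  move=> x hx; apply: cK => d d0; have [y Ky xy] := hx _ d0.
  exists (cons_tuple 0 y) => // i.
  case: (unliftP ord0 i) => [j|] ->; first by rewrite !cons_tupleS.
  by rewrite !cons_tuple0 subrr rnorm0 ltW.
have consB (k : 'I_n.+1 -> H) : k = (fun i => cons_tuple (k ord0) (fun=> 0) i +
    cons_tuple 0 (k \o lift ord0) i).
  apply: funext => i; case: (unliftP ord0 i) => [j|] ->.
    by rewrite !cons_tupleS add0r.
  by rewrite !cons_tuple0 addr0.
have [full|[c [j cj] hc]] := IH K1 sK1 cK1.
  (* [K] contains every tuple with first coordinate 0, so it is the product of [K0] and H^n, and
     plain transitivity decides [K0]. *)
  pose K0 : set H := [set x | K (cons_tuple x (fun=> 0))].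
  have [||||K00|K0T] := @transitive_dichotomy K0.
  - by rewrite /K0 /= -(cons_tuple_ext (z := fun=> 0))//; exact: submod0 sK.
  - move=> x y Kx Ky; have := submodD sK Kx Ky; congr K.
    apply: cons_tuple_ext; first by rewrite !cons_tuple0.
    by move=> i; rewrite !cons_tupleS addr0.
  - move=> m x Am Kx; have := submodM sK Am Kx; congr K.
    apply: cons_tuple_ext => /=; first by rewrite cons_tuple0.
    by move=> i /=; rewrite cons_tupleS (opset0 oA).
  - move=> x hx; apply: cK => d d0; have [y Ky xy] := hx _ d0.
    exists (cons_tuple y (fun=> 0)) => // i.
    case: (unliftP ord0 i) => [j|] ->; last by rewrite !cons_tuple0.
    by rewrite !cons_tupleS subrr rnorm0 ltW.
  - right; exists (fun i => (i == ord0)%:R); first by exists ord0; rewrite oner_neq0.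
    move=> k Kk; rewrite /combination big_ord_recl eqxx scale1r big1 ?addr0//.
      apply: K00; rewrite /K0 /=; have := submodB oA sK Kk (full (k \o lift ord0)).
      congr K; apply: cons_tuple_ext => [|i]; first by rewrite cons_tuple0 subr0.
      by rewrite cons_tupleS subrr.
    by move=> i _; rewrite eq_sym (negPf (neq_lift _ _)) scale0r.
  - left=> k; have := submodD sK (K0T (k ord0)) (full (k \o lift ord0)).
    by rewrite -consB.
(* These are the coefficients of the relation a k_0 + b g(k), where g is the relation found on
   [K1]. *)
pose c' (a b : R[i]) (i : 'I_n.+1) := oapp (fun j => b * c j) a (unlift ord0 i).
have c'E a b k : combination (c' a b) k =
    a *: k ord0 + b *: combination c (k \o lift ord0).
  rewrite /combination big_ord_recl /c' unlift_none /=; congr (_ + _).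
  by rewrite scaler_sumr; apply: eq_bigr => i _; rewrite liftK /= scalerA.
pose L : set (bool -> H) :=
  [set (fun b : bool => if b then k ord0 else combination (c' 0 1) k) | k in K].
have sL : submodule A L.
  split.
  - exists (fun=> 0); first exact: submod0 sK.
    by apply: funext => -[] //; exact: combination0.
  - move=> _ _ [x Kx <-] [y Ky <-]; exists (fun i => x i + y i).
      exact: (submodD sK).
    by apply: funext => -[] //; exact: combinationD.
  - move=> m _ Am [x Kx <-]; exists (m \o x); first exact: (submodM sK).
    by apply: funext => -[] //; exact: (combinationM _ oA).
have gK k : K k -> k ord0 = 0 -> combination (c' 0 1) k = 0.
  move=> Kk k0; rewrite c'E scale0r add0r scale1r hc// /K1 /=.
  by rewrite -(cons_tuple_ext (z := k)).
have [|dL|[a [b [ab hab]]]] := @pair_dichotomy L sL.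
- by move=> _ [k Kk <-] /=; exact: gK.
(* Dense pairs force H = 0, so the only tuple is 0. *)
- left=> x; rewrite (_ : x = fun=> 0); first exact: submod0 sK.
  apply: funext => i; apply: (no_dense_pair sK cK gK) => u v d d0.
  by have [_ [k Kk <-] h] := dL u v d d0; exists k.
- right; exists (c' a b).
    case: ab => [a0|b0]; first by exists ord0; rewrite /c' unlift_none.
    by exists (lift ord0 j); rewrite /c' liftK /= mulf_neq0.
  move=> k Kk; have := hab _ (ex_intro2 _ _ k Kk erefl).
  by rewrite /= !c'E scale0r add0r scale1r.
Qed.

(** The closure of the tuples [S \o xi] is a submodule. If it is everything, the approximation is
    immediate; otherwise one vector is a combination of the others, and by linearity it suffices to
    approximate on those. *)
Lemma finite_approximation n (T : H -> H) (xi : 'I_n -> H) (d : R) :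
    bounded_op T -> 0 < d ->
  exists2 S, A S & forall i, rnorm (T (xi i) - S (xi i)) <= d.
Proof.
move=> bT; elim: n xi d => [|n IH] xi d d0.
  by exists idfun; [exact: transitive_id|case].
have aA := transitive_subalgebra trA.
pose S0 : set ('I_n.+1 -> H) := [set S \o xi | S in A].
have sS0 : submodule A S0.
  split.
  - by exists (fun=> 0); first exact: subalgebra0.
  - by move=> _ _ [S AS <-] [S' AS' <-]; exists (S \+ S'); first exact: subalgebraD.
  - by move=> m _ Am [S AS <-]; exists (m \o S); first exact: subalgebraM.
have [full|[c [i ci] hc]] :=
    submodule_dichotomy (tclosure_submodule oA sS0) (@tclosureK _ _ _ S0).
  by have [_ [S AS <-] h] := full (T \o xi) _ d0; exists S.
(* Since the identity is in [A], the relation holds for [xi] itself. *)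
have := hc xi (tclosure_sub (ex_intro2 _ _ idfun (transitive_id trA) erefl)).
rewrite /combination (bigD1_ord i)//= => xi_i.
pose e j := - ((c i)^-1 * c (lift i j)).
have xiE : xi i = \sum_j e j *: xi (lift i j).
  apply: (scalerI ci); move/eqP: xi_i; rewrite addr_eq0 => /eqP ->.
  rewrite scaler_sumr -sumrN; apply: eq_bigr => j _.
  by rewrite scalerA mulrN mulVKf// scaleNr.
(* E dominates the sum of the |e j|, for the error at [xi i], and is at least 1, for the errors at
   the other vectors. *)
pose E : R := 1 + \sum_j complex.Re `|e j|.
have e0 j : 0 <= complex.Re `|e j| by rewrite -ler0c RRe_real// ger0_real.
have E1 : 1 <= E by rewrite lerDl; exact: sumr_ge0.
have E0 : 0 < E by exact: lt_le_trans E1.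
have [S AS hS] := IH (xi \o lift i) _ (divr_gt0 d0 E0).
exists S => // j; case: (unliftP i j) => [j'|] ->.
  by rewrite (le_trans (hS j'))// ler_pdivrMr// ler_peMr// ltW.
have lin (U : H -> H) : bounded_op U ->
    U (xi i) = \sum_j e j *: U (xi (lift i j)).
  move=> bU; have oU := @bounded_operator_set R H.
  rewrite xiE (big_morph _ (opsetD oU bU) (opset0 oU bU)).
  by apply: eq_bigr => k _; rewrite (opsetZ _ _ oU bU).
rewrite !lin//; last exact: (subalgebra_bounded aA).
rewrite -sumrB (le_trans (_ : _ <= \sum_j complex.Re `|e j| * (d / E)))//.
  elim/big_ind2: _ => [|u u' v v' h h'|k _].
  - by rewrite rnorm0.
  - by rewrite (le_trans (rnormD _ _))// lerD.
  - by rewrite -scalerBr rnormZ ler_wpM2l//; exact: hS.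
rewrite -mulr_suml mulrCA ler_piMr ?(ltW d0)// ler_pdivrMr// mul1r.
by rewrite lerDr.
Qed.

Lemma transitive_strongly_dense : strongly_dense A.
Proof.
move=> T bT B.
(* [F] is generated by the traces on [A] of the basic neighbourhoods of T. Its convergence to T puts
   any neighbourhood B in [F], so that finitely many vectors decide whether B meets [A]. *)
pose F : set_system (H -> H) := [set B | exists (s : seq H) (d : R), 0 < d /\
  forall S, A S -> (forall x, x \in s -> rnorm (T x - S x) <= d) -> B S].
have FF : Filter F.
  split.
  - by exists [::], 1; split.
  - move=> P Q [s [d [d0 hP]]] [s' [d' [d0' hQ]]].
    exists (s ++ s'), (Num.min d d'); split; first by rewrite lt_min d0.
    move=> S AS h; split.
      apply: hP => // x xs; apply: le_trans (h x _) _.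
        by rewrite mem_cat xs.
      by rewrite ge_min lexx.
    apply: hQ => // x xs; apply: le_trans (h x _) _.
      by rewrite mem_cat xs orbT.
    by rewrite ge_min lexx orbT.
  - move=> P Q PQ [s [d [d0 hP]]]; exists s, d; split=> // S AS h.
    exact/PQ/hP.
have cF : {ptws, F --> T}.
  apply/pointwise_cvgP => x; apply/cvgrPdist_lt => e e0.
  have [er e0'] : e = (complex.Re e)%:C%C /\ 0 < complex.Re e.
    by move: e0; case: (e) => a b; rewrite ltcE /= => /andP[/eqP -> ->].
  exists [:: x], (complex.Re e / 2); split; first by rewrite divr_gt0.
  move=> S AS /(_ x (mem_head _ _)) h; rewrite /= er rnormE ltcR.
  by rewrite (le_lt_trans h)//; lra.
move=> /cF [s [d [d0 hB]]].
have [S AS hS] := finite_approximation (fun i : 'I_(size s) => nth 0 s i) bT d0.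
exists S; split=> //; apply: hB => // x xs.
have xi : (index x s < size s)%N by rewrite index_mem.
by have := hS (Ordinal xi); rewrite /= nth_index.
Qed.

End Dichotomies.

Theorem corollary3p2 (R : realType) (H : completeNormedModType R[i])
    (dot : {dot H for Num.conj}) (M A : set (H -> H)) :
  is_hilbert dot ->
  finite_vna dot M -> standard dot M ->
  transitive_algebra A -> M `<=` A ->
  two_fold_transitive A ->
  strongly_dense A.
Proof.
move=> hilb finM stM trA MA tfA.
exact: (transitive_strongly_dense hilb finM stM trA MA tfA).
Qed.
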